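(* Consider the RKHS-UKF described in the context for the unknown system model, where the system satisfies (A1)–(A4) and the coefficient-matrix estimates are projected so that $\|\hat{\mathbf{A}}_k\|\le\bar a$ and $\|\hat{\mathbf{B}}_k\|\le\bar b$ for all $k$. Suppose: (C9) there exist positive reals $\underline{\sigma},\bar\sigma,\bar\gamma,\bar\beta,\tilde r,\bar\alpha,\tilde q,\bar q,\bar r,\bar\phi,\bar f,\bar h$ such that for all $k\ge0$: $\underline{\sigma}\mathbf{I}\preceq\boldsymbol{\Sigma}_{k|k-1}\preceq\bar\sigma\mathbf{I}$, $\|\mathbf{U}^{\phi1}_k\|\le\bar\alpha$, $\|\mathbf{U}^{\phi2}_k\|\le\bar\beta$, $\|\mathbf{U}^{xy}_k\|\le\bar\gamma$, $\mathbf{Q}_k\preceq\bar q\mathbf{I}$, $\mathbf{R}_k\preceq\bar r\mathbf{I}$, $\widetilde{\mathbf{Q}}_k\succeq\tilde q\mathbf{I}$, $\widetilde{\mathbf{R}}_k\succeq\tilde r\mathbf{I}$, $\|\nabla\boldsymbol{\Phi}(\cdot)\|\le\bar\phi$, $\|\boldsymbol{\delta}_f(\cdot)\|_2\le\bar f$, $\|\boldsymbol{\delta}_h(\cdot)\|_2\le\bar h$; (C10) the Jacobian $\nabla\boldsymbol{\Phi}(\mathbf{x})$ at any state $\mathbf{x}$, the true coefficient matrix $\mathbf{A}$, and $\mathbf{U}^{\phi1}_k$ are non-singular for every $k\ge0$; (C11) $\bar\sigma\bar\gamma\bar\phi^2\bar\beta^2\bar b^2<\tilde r$. Then the RKHS-UKF's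 estimation error $\tilde{\mathbf{x}}_k=\mathbf{x}_k-\hat{\mathbf{x}}_{k|k}$ is exponentially bounded in the mean-squared sense.
   Context: System: $\mathbf{x}_k\in\mathbb{R}^{n_x}$, $\mathbf{y}_k\in\mathbb{R}^{n_y}$, unknown $f,h$, with $\mathbf{x}_{k+1}=\Gamma(f(\mathbf{x}_k)+\mathbf{w}_k)=f(\mathbf{x}_k)+\mathbf{w}_k+\boldsymbol{\eta}_k$ ($\Gamma$ the Euclidean projection onto a compact set $\mathcal{X}$, $\boldsymbol{\eta}_k$ the projection error) and $\mathbf{y}_k=h(\mathbf{x}_k)+\mathbf{v}_k$, $\mathbf{w}_k\sim\mathcal{N}(\mathbf{0},\mathbf{Q}_k)$, $\mathbf{v}_k\sim\mathcal{N}(\mathbf{0},\mathbf{R}_k)$ independent, zero-mean, independent across time. Assumptions: (A1) the kernel is Gaussian, $K(\mathbf{x}_i,\mathbf{x}_j)=\exp(-\|\mathbf{x}_i-\mathbf{x}_j\|_2^2/\sigma^2)$, $\sigma>0$. (A2) $\mathbf{x}_k\in\mathcal{X}$ for all $k$, and $f(\mathbf{x})\in\mathcal{X}$ for every $\mathbf{x}$. (A3) the dictionary $\{\tilde{\mathbf{x}}_l\}_{l=1}^L$ is finite of fixed size $L$. (A4) with $\boldsymbol{\Phi}(\mathbf{x})=[K(\tilde{\mathbf{x}}_1,\mathbf{x}),\dots,K(\tilde{\mathbf{x}}_L,\mathbf{x})]^T$, the true coefficient matrices $\mathbf{A}\in\mathbb{R}^{n_x\times L}$, $\mathbf{B}\in\mathbb{R}^{n_y\times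 L}$ satisfy $\|\mathbf{A}\|\le\bar a$, $\|\mathbf{B}\|\le\bar b$, and $f(\mathbf{x})=\mathbf{A}\boldsymbol{\Phi}(\mathbf{x})+\boldsymbol{\delta}_f(\mathbf{x})$, $h(\mathbf{x})=\mathbf{B}\boldsymbol{\Phi}(\mathbf{x})+\boldsymbol{\delta}_h(\mathbf{x})$ define the approximation errors $\boldsymbol{\delta}_f,\boldsymbol{\delta}_h$. $\nabla\boldsymbol{\Phi}(\mathbf{x})=\partial\boldsymbol{\Phi}/\partial\mathbf{x}\in\mathbb{R}^{L\times n_x}$. RKHS-UKF: augmented state $\mathbf{z}_k=[\mathbf{x}_k^T,\mathbf{x}_{k-1}^T]^T$, $n_z=2n_x$, model $\mathbf{z}_k=\widetilde f(\mathbf{z}_{k-1})+\tilde{\mathbf{w}}_{k-1}$ with $\widetilde f(\mathbf{z}_{k-1})=[(\mathbf{A}\boldsymbol{\Phi}(\mathbf{x}_{k-1}))^T,\mathbf{x}_{k-1}^T]^T$, $\tilde{\mathbf{w}}_{k-1}=[\mathbf{w}_{k-1}^T,\mathbf{0}^T]^T$, and $\mathbf{y}_k=\mathbf{B}\boldsymbol{\Phi}(\mathbf{x}_k)+\mathbf{v}_k$. At step $k$ it runs a standard UKF step (sigma points $S_{gen}$ with parameter $\kappa$: $\hat{\mathbf{z}}$ and $\hat{\mathbf{z}}\pm$ columns of the Cholesky factor of $(n_z+\kappa)\boldsymbol{\Sigma}$, weights $\kappa/(n_z+\kappa)$ and $1/(2(n_z+\kappa))$) for this augmented model using the current parameter estimates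 $\hat{\mathbf{A}}_{k-1},\hat{\mathbf{Q}}_{k-1}$ in prediction and $\hat{\mathbf{B}}_{k-1},\hat{\mathbf{R}}_{k-1}$ in the measurement update, producing $\hat{\mathbf{z}}_{k|k-1}$, $\boldsymbol{\Sigma}^z_{k|k-1}$, $\hat{\mathbf{y}}_{k|k-1}$, $\boldsymbol{\Sigma}^y_k$, $\boldsymbol{\Sigma}^{zy}_k$, gain $\mathbf{K}_k=\boldsymbol{\Sigma}^{zy}_k(\boldsymbol{\Sigma}^y_k)^{-1}$, $\hat{\mathbf{z}}_k=\hat{\mathbf{z}}_{k|k-1}+\mathbf{K}_k(\mathbf{y}_k-\hat{\mathbf{y}}_{k|k-1})$, $\boldsymbol{\Sigma}^z_k=\boldsymbol{\Sigma}^z_{k|k-1}-\mathbf{K}_k\boldsymbol{\Sigma}^y_k\mathbf{K}_k^T$; $\hat{\mathbf{x}}_{k|k}$ is the first $n_x$ entries of $\hat{\mathbf{z}}_k$, and $\hat{\mathbf{x}}_{k+1|k}$ those of $\hat{\mathbf{z}}_{k+1|k}$. The parameters are then updated (online approximate EM), with $\hat{\mathbf{A}}_k,\hat{\mathbf{B}}_k$ projected to satisfy the norm bounds of (A4). $\mathbf{K}^1_k$ denotes the first $n_x$ rows of $\mathbf{K}_k$; $\boldsymbol{\Sigma}_{k+1|k}$ is the top-left $n_x\times n_x$ block of $\boldsymbol{\Sigma}^z_{k+1|k}$ and $\boldsymbol{\Sigma}^{xy}_{k+1}$ the first $n_x$ rows of $\boldsymbol{\Sigma}^{zy}_{k+1}$.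 Error model: $\tilde{\mathbf{x}}_{k+1|k}=\mathbf{x}_{k+1}-\hat{\mathbf{x}}_{k+1|k}$, $\tilde{\mathbf{x}}_{k|k}=\mathbf{x}_k-\hat{\mathbf{x}}_{k|k}$, $\tilde{\mathbf{y}}_{k+1}=\mathbf{y}_{k+1}-\hat{\mathbf{y}}_{k+1|k}$. There are unknown diagonal matrices $\mathbf{U}^{\phi1}_k\in\mathbb{R}^{n_x\times n_x}$, $\mathbf{U}^{\phi2}_k\in\mathbb{R}^{n_y\times n_y}$ and matrices $\mathbf{U}^{xy}_k$ such that $\tilde{\mathbf{x}}_{k+1|k}=(\mathbf{A}-\hat{\mathbf{A}}_k)\boldsymbol{\Phi}(\hat{\mathbf{x}}_{k|k})+\mathbf{U}^{\phi1}_k\mathbf{A}\nabla\boldsymbol{\Phi}(\hat{\mathbf{x}}_{k|k})\tilde{\mathbf{x}}_{k|k}+\mathbf{w}_k+\boldsymbol{\eta}_k+\boldsymbol{\delta}_f(\mathbf{x}_k)$, $\tilde{\mathbf{y}}_{k+1}=(\mathbf{B}-\hat{\mathbf{B}}_k)\boldsymbol{\Phi}(\hat{\mathbf{x}}_{k+1|k})+\mathbf{U}^{\phi2}_{k+1}\mathbf{B}\nabla\boldsymbol{\Phi}(\hat{\mathbf{x}}_{k+1|k})\tilde{\mathbf{x}}_{k+1|k}+\mathbf{v}_{k+1}+\boldsymbol{\delta}_h(\mathbf{x}_{k+1})$, and $\boldsymbol{\Sigma}^{xy}_{k+1}=\boldsymbol{\Sigma}_{k+1|k}\mathbf{U}^{xy}_{k+1}\nabla\boldsymbol{\Phi}(\hat{\mathbf{x}}_{k+1|k})^T\mathbf{B}^T\mathbf{U}^{\phi2}_{k+1}$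 (for $n_x\ge n_y$; analogously with $\mathbf{U}^{xy}_{k+1}$ on the right for $n_x<n_y$). The matrices $\widetilde{\mathbf{Q}}_k,\widetilde{\mathbf{R}}_{k+1}$ are defined by $\boldsymbol{\Sigma}_{k+1|k}=\mathbf{M}_k\boldsymbol{\Sigma}_{k|k-1}\mathbf{M}_k^T+\widetilde{\mathbf{Q}}_k$ with $\mathbf{M}_k=\mathbf{U}^{\phi1}_k\mathbf{A}\nabla\boldsymbol{\Phi}(\hat{\mathbf{x}}_{k|k})(\mathbf{I}-\mathbf{K}^1_k\mathbf{U}^{\phi2}_k\mathbf{B}\nabla\boldsymbol{\Phi}(\hat{\mathbf{x}}_{k|k-1}))$, and $\boldsymbol{\Sigma}^y_{k+1}=\mathbf{U}^{\phi2}_{k+1}\mathbf{B}\nabla\boldsymbol{\Phi}(\hat{\mathbf{x}}_{k+1|k})\boldsymbol{\Sigma}_{k+1|k}\nabla\boldsymbol{\Phi}(\hat{\mathbf{x}}_{k+1|k})^T\mathbf{B}^T\mathbf{U}^{\phi2}_{k+1}+\widetilde{\mathbf{R}}_{k+1}$. Exponential mean-squared boundedness of $\{\boldsymbol{\zeta}_k\}$: there exist $\eta,\nu>0$, $0<\lambda<1$ with $\mathbb{E}\|\boldsymbol{\zeta}_k\|_2^2\le\eta\,\mathbb{E}\|\boldsymbol{\zeta}_0\|_2^2\lambda^k+\nu$ for all $k$. *)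

(* Defs.v *)
From HB Require Import structures.
From mathcomp Require Import all_boot all_order all_algebra.
From mathcomp Require Import all_classical all_reals all_analysis.
Set Implicit Arguments. Unset Strict Implicit. Unset Printing Implicit Defensive.
Import Order.TTheory GRing.Theory Num.Theory.
Local Open Scope classical_set_scope.
Local Open Scope ring_scope.

Section Norms.
Variable R : realType.

Definition sqnorm n (v : 'cV[R]_n) : R := \sum_(i < n) (v i 0) ^+ 2.
Definition vnorm n (v : 'cV[R]_n) : R := Num.sqrt (sqnorm v).

Definition opnorm m n (M : 'M[R]_(m, n)) : R :=
  sup [set vnorm (M *m u) | u in [set u : 'cV[R]_n | vnorm u <= 1]].

Definition qform n (M : 'M[R]_n) (u : 'cV[R]_n) : R := (u^T *m M *m u) 0 0.

Definition loewner_le n (M1 M2 : 'M[R]_n) : Prop :=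
  forall u : 'cV[R]_n, qform M1 u <= qform M2 u.

(* non-singular (full rank, for possibly rectangular matrices) *)
Definition full_rank m n (M : 'M[R]_(m, n)) : bool := \rank M == minn m n.

Definition ecvg n (u : nat -> 'cV[R]_n) (p : 'cV[R]_n) : Prop :=
  forall e : R, 0 < e -> exists N : nat, forall k, (N <= k)%N -> vnorm (u k - p) < e.
Definition ecompact n (X : set 'cV[R]_n) : Prop :=
  (exists M : R, forall p, X p -> vnorm p <= M) /\
  (forall (u : nat -> 'cV[R]_n) p, (forall k, X (u k)) -> ecvg u p -> X p).

Definition is_projection n (X : set 'cV[R]_n) (Gamma : 'cV[R]_n -> 'cV[R]_n) : Prop :=
  forall p, X (Gamma p) /\ forall q, X q -> vnorm (p - Gamma p) <= vnorm (p - q).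

(* Cholesky factor: the lower-triangular matrix with positive diagonal S
   such that S S^T = M (exists and is unique when M is positive definite);
   0 if no such matrix exists. *)
Definition is_chol n (M S : 'M[R]_n) : Prop :=
  [/\ forall i j : 'I_n, (i < j)%N -> S i j = 0,
      forall i : 'I_n, 0 < S i i & S *m S^T = M].
Definition chol n (M : 'M[R]_n) : 'M[R]_n := xget 0 [set S | is_chol M S].

End Norms.

Section Kernel.
Variables (R : realType) (nx L : nat) (dict : 'I_L -> 'cV[R]_nx) (sig : R).

Definition gkernel (a b : 'cV[R]_nx) : R := expR (- sqnorm (a - b) / sig ^+ 2).

Definition Phi (x : 'cV[R]_nx) : 'cV[R]_L := \col_(l < L) gkernel (dict l) x.

(* Jacobian dPhi/dx (L x nx): d/dx_j exp(-||d_l - x||^2/s^2)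
   = K(d_l,x) * 2 (d_l j - x_j) / s^2 *)
Definition gradPhi (x : 'cV[R]_nx) : 'M[R]_(L, nx) :=
  \matrix_(l < L, j < nx) (gkernel (dict l) x * (2 * (dict l j 0 - x j 0) / sig ^+ 2)).
End Kernel.

Section Prob.
Context {R : realType} {d : measure_display} {T : measurableType d}.
Variable P : probability T R.

Definition centered_gaussian_rv (X : T -> R) (s2 : R) : Prop :=
  measurable_fun setT X /\
  if s2 == 0 then P [set t | X t = 0] = 1%E
  else forall B : set R, measurable B ->
         P (X @^-1` B) = normal_prob 0 (Num.sqrt s2) B.

Definition gaussian_vec n (w : T -> 'cV[R]_n) (Q : 'M[R]_n) : Prop :=
  forall u : 'cV[R]_n, centered_gaussian_rv (fun t => (u^T *m w t) 0 0) (qform Q u).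

Definition rect_event n (X : T -> 'cV[R]_n) (B : 'I_n -> set R) : set T :=
  [set t | forall i, B i (X t i 0)].

Definition indep_noises nx ny (w : nat -> T -> 'cV[R]_nx) (v : nat -> T -> 'cV[R]_ny) :
  Prop :=
  forall (N : nat) (Bw : nat -> 'I_nx -> set R) (Bv : nat -> 'I_ny -> set R),
    (forall k i, measurable (Bw k i)) -> (forall k i, measurable (Bv k i)) ->
    P (\bigcap_(k in [set k | (k < N)%N]) (rect_event (w k) (Bw k) `&` rect_event (v k) (Bv k)))
    = \big[*%E/1%E]_(k < N) (P (rect_event (w k) (Bw k)) * P (rect_event (v k) (Bv k)))%E.

Definition Esq n (X : T -> 'cV[R]_n) : \bar R := (\int[P]_t (sqnorm (X t))%:E)%E.
End Prob.

Section UKF.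
Variables (R : realType) (nx ny L : nat) (dict : 'I_L -> 'cV[R]_nx) (sig kappa : R).

Local Notation nz := (nx + nx)%N.
Local Notation Phi := (Phi dict sig).

Definition sigma_pt (zh : 'cV[R]_nz) (Sg : 'M[R]_nz) (i : option ('I_nz + 'I_nz)) : 'cV[R]_nz :=
  let C := chol ((nz%:R + kappa) *: Sg) in
  match i with
  | None => zh
  | Some (inl j) => zh + col j C
  | Some (inr j) => zh - col j C
  end.

Definition sigma_wt (i : option ('I_nz + 'I_nz)) : R :=
  if i is None then kappa / (nz%:R + kappa) else (2 * (nz%:R + kappa))^-1.

Definition ftil (Ah : 'M[R]_(nx, L)) (z : 'cV[R]_nz) : 'cV[R]_nz :=
  col_mx (Ah *m Phi (usubmx z)) (usubmx z).

Definition ukf_pred_mean Ah (zS : 'cV[R]_nz * 'M[R]_nz) : 'cV[R]_nz :=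
  \sum_i sigma_wt i *: ftil Ah (sigma_pt zS.1 zS.2 i).
Definition ukf_pred_cov Ah (Qh : 'M[R]_nx) (zS : 'cV[R]_nz * 'M[R]_nz) : 'M[R]_nz :=
  let m := ukf_pred_mean Ah zS in
  \sum_i sigma_wt i *: ((ftil Ah (sigma_pt zS.1 zS.2 i) - m) *m
                        (ftil Ah (sigma_pt zS.1 zS.2 i) - m)^T)
  + block_mx Qh 0 0 0.
Definition ukf_pred Ah Qh zS := (ukf_pred_mean Ah zS, ukf_pred_cov Ah Qh zS).

Definition meas_pt (Bh : 'M[R]_(ny, L)) zS i : 'cV[R]_ny :=
  Bh *m Phi (usubmx (sigma_pt zS.1 zS.2 i)).
Definition ukf_yhat Bh (zS : 'cV[R]_nz * 'M[R]_nz) : 'cV[R]_ny :=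
  \sum_i sigma_wt i *: meas_pt Bh zS i.
Definition ukf_Sy Bh (Rh : 'M[R]_ny) zS : 'M[R]_ny :=
  \sum_i sigma_wt i *: ((meas_pt Bh zS i - ukf_yhat Bh zS) *m
                        (meas_pt Bh zS i - ukf_yhat Bh zS)^T) + Rh.
Definition ukf_Szy Bh (zS : 'cV[R]_nz * 'M[R]_nz) : 'M[R]_(nz, ny) :=
  \sum_i sigma_wt i *: ((sigma_pt zS.1 zS.2 i - zS.1) *m
                        (meas_pt Bh zS i - ukf_yhat Bh zS)^T).
Definition ukf_gain Bh Rh zS : 'M[R]_(nz, ny) := ukf_Szy Bh zS *m invmx (ukf_Sy Bh Rh zS).
Definition ukf_upd Bh Rh (zS : 'cV[R]_nz * 'M[R]_nz) (y : 'cV[R]_ny) :=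
  (zS.1 + ukf_gain Bh Rh zS *m (y - ukf_yhat Bh zS),
   zS.2 - ukf_gain Bh Rh zS *m ukf_Sy Bh Rh zS *m (ukf_gain Bh Rh zS)^T).

(* The filter run.  Parameter estimates: (B0,R0) are the initial ones
   (B^_{-1}, R^_{-1}; A^_{-1}, Q^_{-1} are never used), and Ah k, Bh k, Qh k, Rh k are A^_k, B^_k, Q^_k, R^_k
   (produced by the parameter-update step at time k).  (z0, S0) is the
   prior (z^_{0|-1}, Sigma^z_{0|-1}); ys k is the measurement y_k. *)
Variables (z0 : 'cV[R]_nz) (S0 : 'M[R]_nz)
  (B0 : 'M[R]_(ny, L)) (R0 : 'M[R]_ny)
  (Ah : nat -> 'M[R]_(nx, L)) (Bh : nat -> 'M[R]_(ny, L))
  (Qh : nat -> 'M[R]_nx) (Rh : nat -> 'M[R]_ny) (ys : nat -> 'cV[R]_ny).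

Definition Bprev k := if k is k'.+1 then Bh k' else B0.
Definition Rprev k := if k is k'.+1 then Rh k' else R0.

Fixpoint prior (k : nat) : 'cV[R]_nz * 'M[R]_nz :=
  if k is k'.+1 then
    ukf_pred (Ah k') (Qh k') (ukf_upd (Bprev k') (Rprev k') (prior k') (ys k'))
  else (z0, S0).
Definition post k := ukf_upd (Bprev k) (Rprev k) (prior k) (ys k).

Definition xpost k : 'cV[R]_nx := usubmx (post k).1.
Definition xprior k : 'cV[R]_nx := usubmx (prior k).1.
Definition Sigp k : 'M[R]_nx := ulsubmx (prior k).2.
Definition yhat k : 'cV[R]_ny := ukf_yhat (Bprev k) (prior k).
Definition Sy k : 'M[R]_ny := ukf_Sy (Bprev k) (Rprev k) (prior k).
Definition Sxy k : 'M[R]_(nx, ny) := usubmx (ukf_Szy (Bprev k) (prior k)).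
Definition K1 k : 'M[R]_(nx, ny) := usubmx (ukf_gain (Bprev k) (Rprev k) (prior k)).
End UKF.

(* Main.v *)
Require Import Defs.
From HB Require Import structures.
From mathcomp Require Import all_boot all_order all_algebra.
From mathcomp Require Import all_classical all_reals all_analysis.
From mathcomp Require Import measurable_realfun ring lra.
Import Order.TTheory GRing.Theory Num.Theory.
Import numFieldNormedType.Exports.
Local Open Scope classical_set_scope.
Local Open Scope ring_scope.

(* No stability argument is needed: every source of error except the measurement
   noise is bounded outright. The states lie in a compact set, and the features
   take values in [0, 1], so bounded coefficient matrices give bounded state and
   measurement predictions. The squares in a row of the Cholesky factor of
   (nz + kappa) Sigma sum to a diagonal entry, which (C9) bounds, so the
   cross-covariance is bounded. The innovation covariance is at least rtil I,
   since it exceeds Rtilde by a positive semidefinite matrix, so the gain is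
   bounded. Hence |x_k - x^_{k|k}| <= a + b |v_k| for k >= 1 with constants a, b,
   and the Gaussian noise has second moments bounded uniformly in k. At k = 0 the
   term eta E|x~_0|^2 with eta = 1 is the error itself. *)

(** * Entrywise maximum norm, compared with [vnorm] and [opnorm]; coercive matrices *)

Section MaxNorm.
Context {R : realType}.

Lemma mx_norm_leP m n (M : 'M[R]_(m, n)) c :
  0 <= c -> (forall i j, `|M i j| <= c) -> `|M| <= c.
Proof.
move=> c0 Mc; rewrite [leLHS]/Num.Def.normr /= mx_normrE; apply/bigmax_leP.
by split=> // -[i j] _; exact: Mc.
Qed.

Lemma entry_le_mx_norm m n (M : 'M[R]_(m, n)) i j : `|M i j| <= `|M|.
Proof.
rewrite [leRHS]/Num.Def.normr /= mx_normrE; apply/bigmax_geP; right.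
by exists (i, j).
Qed.

Lemma mx_norm_mulmx m n p (M : 'M[R]_(m, n)) (N : 'M[R]_(n, p)) :
  `|M *m N| <= n%:R * (`|M| * `|N|).
Proof.
apply: mx_norm_leP => [|i j]; first by rewrite !mulr_ge0 ?normr_ge0.
rewrite mxE (le_trans (ler_norm_sum _ _ _))//.
rewrite (le_trans (y := \sum_(k < n) (`|M| * `|N|)))//.
  by apply: ler_sum => k _; rewrite normrM ler_pM ?entry_le_mx_norm.
by rewrite sumr_const card_ord mulr_natl.
Qed.

Lemma mx_norm_usubmx m1 m2 n (M : 'M[R]_(m1 + m2, n)) : `|usubmx M| <= `|M|.
Proof. by apply: mx_norm_leP => // i j; rewrite mxE entry_le_mx_norm. Qed.

Lemma mx_norm_trmx m n (M : 'M[R]_(m, n)) : `|M^T| <= `|M|.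
Proof. by apply: mx_norm_leP => // i j; rewrite mxE entry_le_mx_norm. Qed.

Lemma sqnorm_ge0 n (v : 'cV[R]_n) : 0 <= sqnorm v.
Proof. by apply: sumr_ge0 => i _; exact: sqr_ge0. Qed.

Lemma entry_sqr_le_sqnorm n (v : 'cV[R]_n) i : v i 0 ^+ 2 <= sqnorm v.
Proof.
by rewrite /sqnorm (bigD1 i)//= lerDl sumr_ge0// => j _; exact: sqr_ge0.
Qed.

Lemma mx_norm_le_vnorm n (v : 'cV[R]_n) : `|v| <= vnorm v.
Proof.
apply: mx_norm_leP => [|i j]; first exact: sqrtr_ge0.
by rewrite ord1 -sqrtr_sqr ler_wsqrtr// entry_sqr_le_sqnorm.
Qed.

Lemma mx_norm_sqr_le_sqnorm n (v : 'cV[R]_n) : `|v| ^+ 2 <= sqnorm v.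
Proof.
rewrite -[leRHS]sqr_sqrtr ?sqnorm_ge0// ler_pXn2r ?nnegrE ?sqrtr_ge0//.
exact: mx_norm_le_vnorm.
Qed.

Lemma sqnorm_le n (v : 'cV[R]_n) : sqnorm v <= n%:R * `|v| ^+ 2.
Proof.
rewrite (le_trans (y := \sum_(k < n) `|v| ^+ 2))//; last first.
  by rewrite sumr_const card_ord mulr_natl.
apply: ler_sum => i _; rewrite -real_normK ?num_real// ler_pXn2r ?nnegrE//.
exact: entry_le_mx_norm.
Qed.

(** A supremum dominates its set only if the set is bounded above, so the work lies in a crude upper
    bound for the image of the unit ball, supplied by the maximum norm. *)
Lemma vnorm_le_opnorm m n (M : 'M[R]_(m, n)) u :
  vnorm u <= 1 -> vnorm (M *m u) <= opnorm M.
Proof.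
move=> u1; apply: ub_le_sup; last by exists u.
exists (Num.sqrt (m%:R * (n%:R * `|M|) ^+ 2)) => _ [w /= w1 <-].
rewrite ler_wsqrtr// (le_trans (sqnorm_le _ _))// ler_wpM2l//.
rewrite ler_pXn2r ?nnegrE ?mulr_ge0// (le_trans (mx_norm_mulmx _ _ _ _ _))//.
rewrite ler_wpM2l// ler_piMr//.
by rewrite (le_trans (mx_norm_le_vnorm _ w)).
Qed.

Lemma mx_norm_le_opnorm m n (M : 'M[R]_(m, n)) : `|M| <= opnorm M.
Proof.
have vnorm0 k : vnorm (0 : 'cV[R]_k) = 0.
  by rewrite /vnorm /sqnorm big1 ?sqrtr0// => i _; rewrite mxE expr0n.
apply: mx_norm_leP => [|i j].
  have /vnorm_le_opnorm : vnorm (0 : 'cV[R]_n) <= 1 by rewrite vnorm0.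
  by move=> /(_ _ M); rewrite mulmx0 vnorm0.
have /(vnorm_le_opnorm _ _ M) : vnorm (delta_mx j 0 : 'cV[R]_n) <= 1.
  rewrite /vnorm /sqnorm (bigD1 j)//= big1 ?addr0.
    by rewrite mxE !eqxx expr1n sqrtr1.
  by move=> k kj; rewrite mxE (negbTE kj) expr0n.
apply: le_trans; rewrite -colE.
have := entry_le_mx_norm _ _ (col j M) i 0; rewrite mxE => /le_trans; apply.
exact: mx_norm_le_vnorm.
Qed.

Lemma qform_delta n (M : 'M[R]_n) i : qform M (delta_mx i 0) = M i i.
Proof. by rewrite /qform trmx_delta -rowE -colE !mxE. Qed.

Lemma qform_scalar n c (u : 'cV[R]_n) : qform c%:M u = c * sqnorm u.
Proof.
rewrite /qform mul_mx_scalar -scalemxAl !mxE; congr (_ * _).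
by apply: eq_bigr => i _; rewrite mxE expr2.
Qed.

Lemma diag_loewner n (M : 'M[R]_n) a b :
  loewner_le a%:M M -> loewner_le M b%:M -> forall i, a <= M i i <= b.
Proof.
move=> aM Mb i; move: (aM (delta_mx i 0)) (Mb (delta_mx i 0)).
by rewrite !qform_delta !mxE eqxx => -> ->.
Qed.

(** A row [k] of the left kernel makes the form vanish at [k^T], and coercivity then forces
    [k = 0]. *)
Lemma coercive_unitmx n (M : 'M[R]_n) r : 0 < r ->
  (forall u, r * sqnorm u <= qform M u) -> M \in unitmx.
Proof.
move=> r0 rM; rewrite -row_free_unit -kermx_eq0; apply/eqP/row_matrixP => i.
rewrite row0; set k := row i _.
have kM : k *m M = 0 by apply/sub_kermxP; exact: row_sub.
have := rM k^T; rewrite /qform trmxK kM mul0mx mxE pmulr_rle0// => k0.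
apply/matrixP => a j; rewrite ord1 [RHS]mxE; apply/eqP; rewrite -sqrf_eq0.
have := le_trans (entry_sqr_le_sqnorm _ k^T j) k0.
by rewrite mxE eq_le sqr_ge0 andbT.
Qed.

(** With [s = invmx M *m e], coercivity bounds [r * |s|^2] by [s^T M s = s^T e], which is at most
    [n * |s| * |e|]; divide by [|s|]. *)
Lemma mx_norm_invmx_mul n (M : 'M[R]_n) r (e : 'cV[R]_n) : 0 < r ->
  (forall u, r * sqnorm u <= qform M u) ->
  `|invmx M *m e| <= n%:R / r * `|e|.
Proof.
move=> r0 rM; set s := invmx M *m e.
have Ms : M *m s = e by rewrite mulmxA mulmxV ?mul1mx// (coercive_unitmx _ _ _ r0).
have [->|s0] := eqVneq s 0; first by rewrite normr0 !mulr_ge0// ltW// invr_gt0.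
have {}s0 : 0 < `|s| by rewrite normr_gt0.
have : r * `|s| ^+ 2 <= n%:R * (`|s| * `|e|).
  rewrite (le_trans (y := r * sqnorm s))//.
    by rewrite ler_wpM2l ?mx_norm_sqr_le_sqnorm// ltW.
  rewrite (le_trans (rM s))// /qform -mulmxA Ms (le_trans (ler_norm _))//.
  rewrite (le_trans (entry_le_mx_norm _ _ _ _ _))//.
  rewrite (le_trans (mx_norm_mulmx _ _ _ _ _))// ler_wpM2l// ler_wpM2r//.
  exact: mx_norm_trmx.
rewrite expr2 mulrCA mulrA [leRHS]mulrCA -mulrA ler_pM2l// => h.
by rewrite mulrAC ler_pdivlMr// mulrC.
Qed.

End MaxNorm.

(** * Integrals of nonnegative functions and one-sided change of measure *)

Section Integrals.
Context d (T : measurableType d) (R : realType).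
Local Open Scope ereal_scope.

(* Unlike [ge0_le_integral], this needs no measurability: the integral of a
   nonnegative function is a supremum over the simple functions below it. *)
Lemma le_integral_nonneg (mu : {measure set T -> \bar R}) (f g : T -> \bar R) :
  (forall t, 0 <= f t) -> (forall t, f t <= g t) ->
  \int[mu]_t f t <= \int[mu]_t g t.
Proof.
move=> f0 fg; have g0 t : 0 <= g t by exact: le_trans (f0 t) (fg t).
rewrite !ge0_integralTE//; apply: ereal_sup_le => _ [h /= hf <-].
by exists h => // t; exact: le_trans (hf t) (fg t).
Qed.

Import HBNNSimple.

(** It suffices to treat simple [h] below [f]: level set by level set, the integral of [h] against
    [nu] is that of [h * p] against [mu]. *)
Lemma integral_density_le (mu nu : {measure set T -> \bar R}) (p : T -> R)
    (f : T -> \bar R) :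
  measurable_fun setT p -> (forall t, 0 <= p t)%R ->
  (forall A, measurable A -> nu A = \int[mu]_(t in A) (p t)%:E) ->
  (forall t, 0 <= f t) ->
  \int[nu]_t f t <= \int[mu]_t (f t * (p t)%:E).
Proof.
move=> mp p0 nuE f0; rewrite (ge0_integralTE nu)//.
apply: ge_ereal_sup => _ [h /= hf <-].
have mindic r : measurable_fun setT (\1_(h @^-1` [set r]) : T -> R).
  exact: measurable_indic.
have indic_ge0 r t : (0 <= r * \1_(h @^-1` [set r]) t * p t)%R.
  by rewrite mulr_ge0// -lee_fin EFinM nnfun_muleindic_ge0.
apply: (@le_trans _ _ (\int[mu]_t ((h t)%:E * (p t)%:E))); last first.
  apply: le_integral_nonneg => t; first by rewrite mule_ge0 ?lee_fin.
  by rewrite lee_wpmul2r// lee_fin.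
rewrite (_ : sintegral nu h = \int[mu]_t
    (\sum_(r \in range h) (r * \1_(h @^-1` [set r]) t * p t)%:E)); last first.
  rewrite ge0_integral_fsum//; last 2 first.
  - move=> r; apply/measurable_EFinP; apply: measurable_funM => //.
    by apply: measurable_funM => //; exact: measurable_cst.
  - by move=> r t _; rewrite lee_fin indic_ge0.
  rewrite sintegralE; apply: eq_fsbigr => _ /set_mem[t _ <-].
  under eq_integral => u _ do rewrite -mulrA EFinM.
  rewrite ge0_integralZl_EFin//; last 2 first.
  - by move=> u _; rewrite lee_fin mulr_ge0.
  - by apply/measurable_EFinP; exact: measurable_funM.
  rewrite nuE// [in LHS]integral_mkcond; congr (_ * _).
  by apply: eq_integral => u _; rewrite epatch_indic muleC EFinM.
apply: le_integral_nonneg => u.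
  by apply: fsume_ge0 => r _; rewrite lee_fin indic_ge0.
by rewrite fsumEFin// -mulr_fsuml -fimfunE EFinM.
Qed.
End Integrals.

(** * Second moments of Gaussian variables and vectors *)

Section Gaussian.
Context {R : realType}.

(** Doubling the deviation slows the decay enough to absorb the factor [x ^+ 2], so a second moment
    is bounded by the total mass of a wider Gaussian. *)
Lemma sqr_normal_pdf_le (s x : R) :
  x ^+ 2 * normal_pdf 0 s x <= (8 * s ^+ 2 + 1) * normal_pdf 0 (2 * s) x.
Proof.
have [->|s0] := eqVneq s 0.
  rewrite mulr0 expr0n/= mulr0 add0r mul1r /normal_pdf eqxx indicE.
  case: (boolP (x \in _)) => [|_]; last by rewrite mulr0.
  by rewrite inE/= in_itv/= => /andP[x0 x1]; rewrite mulr1 expr_le1.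
have s20 : 2 * s != 0 by rewrite mulf_neq0.
rewrite !normal_pdfE// /normal_peak /normal_fun !subr0.
have ss : 0 < s ^+ 2 by rewrite exprn_even_gt0.
have -> : (2 * s) ^+ 2 * pi *+ 2 = 2 ^+ 2 * (s ^+ 2 * pi *+ 2).
  by ring.
rewrite sqrtrM ?sqr_ge0// sqrtr_sqr ger0_norm// invfM.
set c := (Num.sqrt _)^-1; have c0 : 0 <= c by rewrite invr_ge0 sqrtr_ge0.
(* [q] is the gap between the two exponents, [x^2 / (2 s^2) - x^2 / (8 s^2)]. *)
set q := 3 * x ^+ 2 / (8 * s ^+ 2).
have -> : - x ^+ 2 / (s ^+ 2 *+ 2) = - q + - x ^+ 2 / ((2 * s) ^+ 2 *+ 2).
  by rewrite /q; field; rewrite s0.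
rewrite expRD; set g := expR (- x ^+ 2 / _); have g0 : 0 <= g by exact: expR_ge0.
(* Since [x^2 = 8/3 s^2 q] and [q < exp q], even [8/3 s^2] would do. The wider density has half the
   peak, which turns 4 into the 8 of the statement. *)
have : x ^+ 2 * expR (- q) <= 4 * s ^+ 2.
  rewrite expRN ler_pdivrMr ?expR_gt0//.
  have : 1 + q <= expR q by exact: expR_ge1Dx.
  have -> : x ^+ 2 = 8 / 3 * s ^+ 2 * q by rewrite /q; field; rewrite s0.
  have q0 : 0 <= q.
    by apply: divr_ge0; apply: mulr_ge0; rewrite ?sqr_ge0//; exact: ler0n.
  by nra.
move=> /(ler_wpM2r (mulr_ge0 c0 g0)).
have cg0 := mulr_ge0 c0 g0; have {}ss := ltW ss.
by nra.
Qed.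

End Gaussian.

Section GaussianMoment.
Context {R : realType} {d : measure_display} {T : measurableType d}.
Variable P : probability T R.

(* The factor 8 is not sharp, and the summand 1 absorbs the junk case of a
   negative [s2], where [normal_prob 0 0] is the uniform law on [0, 1]. *)
Lemma gaussian_second_moment (X : T -> R) (s2 r : R) :
  centered_gaussian_rv P X s2 -> 0 <= r -> s2 <= r ->
  (\int[P]_t (X t ^+ 2)%:E <= (8 * r + 1)%:E)%E.
Proof.
move=> [mX +] r0 s2r; case: ifPn => [_ PX|_ PX].
  have mA : measurable [set t | X t = 0].
    rewrite -[X in measurable X]setTI.
    exact: (mX measurableT [set 0] (measurable_set1 0)).
  have X0 : ae_eq P setT (fun t => (X t ^+ 2)%:E) (cst 0%E).
    exists (~` [set t | X t = 0]); split.
    - exact: measurableC.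
    - by rewrite [LHS]probability_setC// PX subee.
    - by move=> t /= tX Xt; apply: tX => _; rewrite Xt expr0n.
  rewrite (ge0_ae_eq_integral _ _ _ _ _ X0)//; last 2 first.
  - by apply/measurable_EFinP; exact: measurable_funX.
  - by move=> t _; rewrite lee_fin sqr_ge0.
  by rewrite integral0 lee_fin addr_ge0// mulr_ge0.
have mX' : measurable_fun setT (X : T -> measurableTypeR R) := mX.
pose Y : {mfun T >-> measurableTypeR R} :=
  @mfun_Sub _ _ T (measurableTypeR R) X (mem_set mX').
pose s := Num.sqrt s2.
have s2r' : s ^+ 2 <= r.
  have [s20|/ltW s20] := leP 0 s2; first by rewrite sqr_sqrtr.
  by rewrite /s ler0_sqrtr// expr0n.
have mp : measurable_fun setT (normal_pdf 0 (2 * s)) := measurable_normal_pdf 0 (2 * s).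
(* Pass to the law of [X], then to its density, then to the wider Gaussian, whose total mass is
   1. *)
rewrite -[leLHS](@ge0_integral_distribution _ _ _ _ _ P Y (fun y => (y ^+ 2)%:E)).
- apply: (@le_trans _ _ (\int[lebesgue_measure]_y
      ((y ^+ 2)%:E * (normal_pdf 0 s y)%:E)))%E.
    apply: (@integral_density_le _ _ _ lebesgue_measure (distribution P Y)
      (normal_pdf 0 s) (fun y : R => (y ^+ 2)%:E)).
    + exact: measurable_normal_pdf.
    + exact: normal_pdf_ge0.
    + by move=> A mA; rewrite -/(normal_prob 0 s A) -PX.
    + by move=> y; rewrite lee_fin sqr_ge0.
  apply: (@le_trans _ _ (\int[lebesgue_measure]_y
      ((8 * s ^+ 2 + 1)%:E * (normal_pdf 0 (2 * s) y)%:E)))%E.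
    apply: le_integral_nonneg => y; rewrite -EFinM lee_fin.
      by rewrite mulr_ge0 ?sqr_ge0 ?normal_pdf_ge0.
    exact: sqr_normal_pdf_le.
  rewrite ge0_integralZl_EFin//.
  + by rewrite integral_normal_pdf mule1 lee_fin lerD2r ler_wpM2l.
  + by move=> y _; rewrite lee_fin normal_pdf_ge0.
  + by apply/measurable_EFinP.
  + by rewrite addr_ge0// mulr_ge0// sqr_ge0.
- by apply/measurable_EFinP; exact: measurable_funX.
- by move=> y; rewrite lee_fin sqr_ge0.
Qed.

(** Testing against basis vectors makes each coordinate a centered Gaussian with variance a diagonal
    entry of [Q], hence at most [r]. *)
Lemma gaussian_vec_Esq n (v : T -> 'cV[R]_n) (Q : 'M[R]_n) (r : R) :
  gaussian_vec P v Q -> 0 <= r -> loewner_le Q r%:M ->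
  measurable_fun setT (fun t => sqnorm (v t)) /\
  (Esq P v <= (n%:R * (8 * r + 1))%:E)%E.
Proof.
move=> gv r0 Qr.
have coord t i : ((delta_mx i 0 : 'cV[R]_n)^T *m v t) 0 0 = v t i 0.
  by rewrite trmx_delta -rowE mxE.
have gvi i : centered_gaussian_rv P (fun t => v t i 0) (Q i i).
  by have := gv (delta_mx i 0); rewrite qform_delta; under eq_fun do rewrite coord.
have mv i : measurable_fun setT (fun t => v t i 0 ^+ 2).
  by apply: measurable_funX; case: (gvi i).
split; first by apply: measurable_sum.
rewrite /Esq; under eq_integral => t _ do rewrite /sqnorm -sumEFin.
rewrite ge0_integral_sum//; last 2 first.
- by move=> i; apply/measurable_EFinP.
- by move=> i t _; rewrite lee_fin sqr_ge0.
have -> : (n%:R * (8 * r + 1))%:E = (\sum_(i < n) (8 * r + 1)%:E)%E.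
  by rewrite sumEFin sumr_const card_ord mulr_natl.
apply: lee_sum => i _; apply: gaussian_second_moment (gvi i) r0 _.
by have := Qr (delta_mx i 0); rewrite !qform_delta mxE eqxx.
Qed.

End GaussianMoment.

(** * Bounds on the predictions, the cross-covariance and the gain of one filter step *)

Section UKFBounds.
Context {R : realType} {nx ny L : nat}.
Variables (dict : 'I_L -> 'cV[R]_nx) (sig kappa : R).
Local Notation nz := (nx + nx)%N.
Local Notation wt := (@sigma_wt R nx kappa).

(** No sign is imposed on [kappa], so weights can be negative and the sum of absolute values
    replaces the usual total 1. *)
Definition weight_mass : R := \sum_i `|wt i|.

Lemma weight_mass_ge0 : 0 <= weight_mass.
Proof. exact: sumr_ge0. Qed.

Lemma mx_norm_weighted_sum m n (F : _ -> 'M[R]_(m, n)) c :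
  (forall i, `|F i| <= c) -> `|\sum_i wt i *: F i| <= weight_mass * c.
Proof.
move=> Fc; rewrite (le_trans (ler_norm_sum _ _ _))// mulr_suml.
by apply: ler_sum => i _; rewrite mx_normZ ler_wpM2l.
Qed.

Lemma mx_norm_Phi p : `|Phi dict sig p| <= 1.
Proof.
apply: mx_norm_leP => // i j; rewrite mxE /gkernel ger0_norm ?expR_ge0//.
rewrite -expR0 ler_expR mulNr oppr_le0 mulr_ge0 ?sqnorm_ge0// invr_ge0.
exact: sqr_ge0.
Qed.

Lemma mx_norm_mulPhi m (C : 'M[R]_(m, L)) c p :
  `|C| <= c -> `|C *m Phi dict sig p| <= L%:R * c.
Proof.
move=> Cc; rewrite (le_trans (mx_norm_mulmx _ _ _ _ _))// ler_wpM2l//.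
by apply: le_trans Cc; rewrite ler_piMr// mx_norm_Phi.
Qed.

Lemma mx_norm_pred_mean (Ah : 'M[R]_(nx, L)) a zS : `|Ah| <= a ->
  `|usubmx (ukf_pred_mean dict sig kappa Ah zS)| <= weight_mass * (L%:R * a).
Proof.
move=> Aa; rewrite /ukf_pred_mean linear_sum/=.
under eq_bigr do rewrite linearZ/= /ftil col_mxKu.
by apply: mx_norm_weighted_sum => i; exact: mx_norm_mulPhi.
Qed.

Lemma mx_norm_yhat (Bh : 'M[R]_(ny, L)) b zS : `|Bh| <= b ->
  `|ukf_yhat dict sig kappa Bh zS| <= weight_mass * (L%:R * b).
Proof. by move=> Bb; apply: mx_norm_weighted_sum => i; exact: mx_norm_mulPhi. Qed.

(* The squares in row [i] of a Cholesky factor of [M] add up to [M i i]; the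
   bound also covers the junk value [chol M = 0]. *)
Lemma chol_entry n (M : 'M[R]_n) i j : chol M i j ^+ 2 <= `|M i i|.
Proof.
rewrite /chol; case: xgetP => [S _ [_ _ <-]|_]; last by rewrite mxE expr0n/= normr_ge0.
rewrite mxE (bigD1 j)//= mxE -expr2.
apply: le_trans (ler_norm _); rewrite lerDl sumr_ge0// => k _.
by rewrite mxE -expr2 sqr_ge0.
Qed.

(** The top half of a deviation reads only the first [nx] rows of the Cholesky factor, and these are
    controlled by the diagonal of the top-left block, the block that (C9) bounds. *)
Lemma mx_norm_sigma_dev zh (Sg : 'M[R]_nz) s i :
  (forall j, `|ulsubmx Sg j j| <= s) ->
  `|usubmx (sigma_pt kappa zh Sg i - zh)| <= Num.sqrt (`|nz%:R + kappa| * s).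
Proof.
move=> Sgs; set C := chol ((nz%:R + kappa) *: Sg).
have colC j : `|usubmx (col j C)| <= Num.sqrt (`|nz%:R + kappa| * s).
  apply: mx_norm_leP => [|a b]; first exact: sqrtr_ge0.
  rewrite -sqrtr_sqr ler_wsqrtr// !mxE (le_trans (chol_entry _ _ _ _))//.
  rewrite mxE normrM ler_wpM2l//.
  by have := Sgs a; rewrite !mxE.
case: i => [[j|j]|] /=.
- by rewrite addrAC subrr add0r; exact: colC.
- by rewrite addrAC subrr add0r linearN normrN; exact: colC.
- by rewrite subrr linear0 normr0 sqrtr_ge0.
Qed.

Lemma mx_norm_Sxy (Bh : 'M[R]_(ny, L)) b (zS : 'cV[R]_nz * 'M[R]_nz) s :
  `|Bh| <= b -> (forall j, `|ulsubmx zS.2 j j| <= s) ->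
  `|usubmx (ukf_Szy dict sig kappa Bh zS)| <=
    weight_mass * (Num.sqrt (`|nz%:R + kappa| * s)
                   * (L%:R * b + weight_mass * (L%:R * b))).
Proof.
move=> Bb zs; rewrite /ukf_Szy linear_sum/=.
under eq_bigr do rewrite linearZ/= -mul_usub_mx.
apply: mx_norm_weighted_sum => i.
(* An outer product has inner dimension 1, so the dimension factor is 1. *)
rewrite (le_trans (mx_norm_mulmx _ _ _ _ _))// mul1r ler_pM//.
  exact: mx_norm_sigma_dev.
rewrite (le_trans (mx_norm_trmx _ _ _))// (le_trans (ler_normB _ _))//.
by rewrite lerD ?mx_norm_yhat// mx_norm_mulPhi.
Qed.

Lemma mx_norm_gain_mul (Bh : 'M[R]_(ny, L)) (Rh : 'M[R]_ny)
    (zS : 'cV[R]_nz * 'M[R]_nz) r c (e : 'cV[R]_ny) : 0 < r ->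
  (forall u, r * sqnorm u <= qform (ukf_Sy dict sig kappa Bh Rh zS) u) ->
  `|usubmx (ukf_Szy dict sig kappa Bh zS)| <= c ->
  `|usubmx (ukf_gain dict sig kappa Bh Rh zS *m e)|
    <= ny%:R * (c * (ny%:R / r * `|e|)).
Proof.
move=> r0 Syr Sc; rewrite /ukf_gain -mulmxA -mul_usub_mx.
rewrite (le_trans (mx_norm_mulmx _ _ _ _ _))// ler_wpM2l// ler_pM//.
exact: mx_norm_invmx_mul.
Qed.

End UKFBounds.

(* A diagonal [U] is symmetric, so the subtracted matrix is [N Sg N^T] with
   [N = U B G], which is positive semidefinite. *)
Lemma coercive_innovation {R : realType} {m n L : nat} (S : 'M[R]_m)
    (U : 'M[R]_m) (B : 'M[R]_(m, L)) (G : 'M[R]_(L, n)) (Sg : 'M[R]_n) s r :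
  is_diag_mx U -> 0 <= s -> loewner_le s%:M Sg ->
  loewner_le r%:M (S - U *m B *m G *m Sg *m G^T *m B^T *m U) ->
  forall u, r * sqnorm u <= qform S u.
Proof.
move=> /diag_mxP[D ->] s0 sS rS u.
have := rS u; rewrite qform_scalar => /le_trans; apply.
set N := diag_mx D *m B *m G.
have -> : N *m Sg *m G^T *m B^T *m diag_mx D = N *m Sg *m N^T.
  by rewrite /N !trmx_mul tr_diag_mx !mulmxA.
rewrite /qform mulmxBr mulmxBl.
have -> : u^T *m (N *m Sg *m N^T) *m u = (N^T *m u)^T *m Sg *m (N^T *m u).
  by rewrite [(N^T *m u)^T]trmx_mul trmxK !mulmxA.
rewrite mxE [X in _ + X <= _]mxE gerBl.
apply: le_trans (sS (N^T *m u)).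
by rewrite qform_scalar mulr_ge0 ?sqnorm_ge0.
Qed.

(** * From a pointwise affine bound to the mean-square bound *)

Lemma sqnorm_affine_bound {R : realType} m n (e : 'cV[R]_m) (v : 'cV[R]_n) a b :
  0 <= a -> 0 <= b -> `|e| <= a + b * `|v| ->
  sqnorm e <= m%:R * (2 * a ^+ 2) + m%:R * (2 * b ^+ 2) * sqnorm v.
Proof.
move=> a0 b0 eab; apply: le_trans (sqnorm_le _ _) _.
rewrite -mulrA -mulrDr ler_wpM2l//.
have : `|e| ^+ 2 <= (a + b * `|v|) ^+ 2.
  by rewrite ler_pXn2r ?nnegrE ?addr_ge0 ?mulr_ge0.
move=> /le_trans; apply.
have : b ^+ 2 * `|v| ^+ 2 <= b ^+ 2 * sqnorm v.
  by rewrite ler_wpM2l ?sqr_ge0 ?mx_norm_sqr_le_sqnorm.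
have := sqr_ge0 (a - b * `|v|).
by nra.
Qed.

(** The error depends on parameter estimates that are arbitrary functions of the outcome, so it is
    first replaced by its bound in [v]; only then is the integral split. *)
Lemma Esq_affine_bound {R : realType} {d} {T : measurableType d}
    (P : probability T R) m n (e : T -> 'cV[R]_m) (v : T -> 'cV[R]_n) c1 c2 r :
  measurable_fun setT (fun t => sqnorm (v t)) -> 0 <= c1 -> 0 <= c2 ->
  (forall t, sqnorm (e t) <= c1 + c2 * sqnorm (v t)) -> (Esq P v <= r%:E)%E ->
  (Esq P e <= (c1 + c2 * r)%:E)%E.
Proof.
move=> mv c10 c20 ev vr.
apply: (@le_trans _ _ (\int[P]_t (c1%:E + c2%:E * (sqnorm (v t))%:E))%E).
  apply: le_integral_nonneg => t; first by rewrite lee_fin sqnorm_ge0.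
  by rewrite -EFinM -EFinD lee_fin.
have mvE : measurable_fun setT (fun t => (sqnorm (v t))%:E) by apply/measurable_EFinP.
rewrite ge0_integralD//; last 2 first.
- by move=> t _; rewrite mule_ge0// lee_fin ?sqnorm_ge0.
- exact: measurable_funeM.
rewrite integral_cst//= probability_setT mule1 EFinD leeD2l//.
rewrite ge0_integralZl_EFin//; last by move=> t _; rewrite lee_fin sqnorm_ge0.
by rewrite EFinM lee_wpmul2l// lee_fin.
Qed.

Theorem theorem4
  (R : realType) (d : measure_display) (T : measurableType d) (P : probability T R)
  (nx ny L : nat) (dict : 'I_L -> 'cV[R]_nx) (sig kappa : R)
  (X : set 'cV[R]_nx) (Gamma : 'cV[R]_nx -> 'cV[R]_nx)
  (f : 'cV[R]_nx -> 'cV[R]_nx) (h : 'cV[R]_nx -> 'cV[R]_ny)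
  (A : 'M[R]_(nx, L)) (B : 'M[R]_(ny, L)) (abar bbar : R)
  (Q : nat -> 'M[R]_nx) (Rn : nat -> 'M[R]_ny)
  (x w : nat -> T -> 'cV[R]_nx) (v y : nat -> T -> 'cV[R]_ny)
  (z0 : 'cV[R]_(nx + nx)) (S0 : 'M[R]_(nx + nx))
  (B0 : 'M[R]_(ny, L)) (R0 : 'M[R]_ny)
  (Ah : nat -> T -> 'M[R]_(nx, L)) (Bh : nat -> T -> 'M[R]_(ny, L))
  (Qh : nat -> T -> 'M[R]_nx) (Rh : nat -> T -> 'M[R]_ny)
  (sigl sigb gamb betb rtil alpb qtil qbar rbar phib fbar hbar : R) :
  (* the RKHS-UKF run (on outcome t) *)
  let xpo k t := xpost dict sig kappa z0 S0 B0 R0 (Ah^~ t) (Bh^~ t) (Qh^~ t) (Rh^~ t) (y^~ t) k in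
  let xpr k t := xprior dict sig kappa z0 S0 B0 R0 (Ah^~ t) (Bh^~ t) (Qh^~ t) (Rh^~ t) (y^~ t) k in
  let Sp k t := Sigp dict sig kappa z0 S0 B0 R0 (Ah^~ t) (Bh^~ t) (Qh^~ t) (Rh^~ t) (y^~ t) k in
  let yh k t := yhat dict sig kappa z0 S0 B0 R0 (Ah^~ t) (Bh^~ t) (Qh^~ t) (Rh^~ t) (y^~ t) k in
  let Syy k t := Sy dict sig kappa z0 S0 B0 R0 (Ah^~ t) (Bh^~ t) (Qh^~ t) (Rh^~ t) (y^~ t) k in
  let Sxy_ k t := Sxy dict sig kappa z0 S0 B0 R0 (Ah^~ t) (Bh^~ t) (Qh^~ t) (Rh^~ t) (y^~ t) k in
  let K1_ k t := K1 dict sig kappa z0 S0 B0 R0 (Ah^~ t) (Bh^~ t) (Qh^~ t) (Rh^~ t) (y^~ t) k in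
  let Ph := Phi dict sig in
  let G := gradPhi dict sig in
  (* (A1) Gaussian kernel *)
  0 < sig ->
  (* system model *)
  ecompact X -> is_projection X Gamma ->
  (forall k t, x k.+1 t = Gamma (f (x k t) + w k t)) ->
  (forall k t, y k t = h (x k t) + v k t) ->
  (forall k, gaussian_vec P (w k) (Q k)) ->
  (forall k, gaussian_vec P (v k) (Rn k)) ->
  indep_noises P w v ->
  (* (A2) *)
  (forall k t, X (x k t)) -> (forall p, X (f p)) ->
  (* (A4) and projected estimates *)
  opnorm A <= abar -> opnorm B <= bbar ->
  opnorm B0 <= bbar ->
  (forall k t, opnorm (Ah k t) <= abar) -> (forall k t, opnorm (Bh k t) <= bbar) ->
  (* (C9) *)
  0 < sigl -> 0 < sigb -> 0 < gamb -> 0 < betb -> 0 < rtil -> 0 < alpb ->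
  0 < qtil -> 0 < qbar -> 0 < rbar -> 0 < phib -> 0 < fbar -> 0 < hbar ->
  (forall k, loewner_le (Q k) (qbar%:M)) ->
  (forall k, loewner_le (Rn k) (rbar%:M)) ->
  (forall p, opnorm (G p) <= phib) ->
  (forall p, vnorm (f p - A *m Ph p) <= fbar) ->
  (forall p, vnorm (h p - B *m Ph p) <= hbar) ->
  (forall k t, loewner_le (sigl%:M) (Sp k t) /\ loewner_le (Sp k t) (sigb%:M)) ->
  (* (C10) *)
  (forall p, full_rank (G p)) -> full_rank A ->
  (* error model, with the bounds of (C9) and (C10) on the U matrices *)
  (exists (U1 : nat -> T -> 'M[R]_nx) (U2 : nat -> T -> 'M[R]_ny),
     (forall k t, is_diag_mx (U1 k t) /\ is_diag_mx (U2 k t)) /\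
         (forall k t, opnorm (U1 k t) <= alpb /\ opnorm (U2 k t) <= betb) /\
         (forall k t, U1 k t \in unitmx) /\
         (forall k t, x k.+1 t - xpr k.+1 t =
            (A - Ah k t) *m Ph (xpo k t) + U1 k t *m A *m G (xpo k t) *m (x k t - xpo k t)
            + w k t + (x k.+1 t - f (x k t) - w k t) + (f (x k t) - A *m Ph (x k t))) /\
         (forall k t, y k.+1 t - yh k.+1 t =
            (B - Bh k t) *m Ph (xpr k.+1 t)
            + U2 k.+1 t *m B *m G (xpr k.+1 t) *m (x k.+1 t - xpr k.+1 t)
            + v k.+1 t + (h (x k.+1 t) - B *m Ph (x k.+1 t))) /\
         ((ny <= nx)%N -> exists Uxy : nat -> T -> 'M[R]_nx,
            (forall k t, opnorm (Uxy k t) <= gamb) /\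
            (forall k t, Sxy_ k.+1 t =
               Sp k.+1 t *m Uxy k.+1 t *m (G (xpr k.+1 t))^T *m B^T *m U2 k.+1 t)) /\
         ((nx < ny)%N -> exists Uxy : nat -> T -> 'M[R]_ny,
            (forall k t, opnorm (Uxy k t) <= gamb) /\
            (forall k t, Sxy_ k.+1 t =
               Sp k.+1 t *m (G (xpr k.+1 t))^T *m B^T *m U2 k.+1 t *m Uxy k.+1 t)) /\
         (forall k t,
            let M := U1 k t *m A *m G (xpo k t)
                     *m (1%:M - K1_ k t *m U2 k t *m B *m G (xpr k t)) in
            loewner_le (qtil%:M) (Sp k.+1 t - M *m Sp k t *m M^T)) /\
         (forall k t,
            loewner_le (rtil%:M)
              (Syy k t - U2 k t *m B *m G (xpr k t) *m Sp k t
                           *m (G (xpr k t))^T *m B^T *m U2 k t))) ->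
  (* (C11) *)
  sigb * gamb * phib ^+ 2 * betb ^+ 2 * bbar ^+ 2 < rtil ->
  (* conclusion: exponential mean-square boundedness of x_k - x^_{k|k} *)
  exists eta nu lam : R, [/\ 0 < eta, 0 < nu, 0 < lam, lam < 1 &
    forall k : nat,
      (Esq P (fun t => (x k t - xpo k t)%R)
       <= eta%:E * Esq P (fun t => (x 0%N t - xpo 0%N t)%R) * (lam ^+ k)%:E + nu%:E)%E].

Proof.
move=> xpo xpr Sp yh Syy Sxy_ K1_ Ph G.
move=> sig0 Xc Gp xS yS wg vg _ xX _ Aa Bb B0b Ahb Bhb.
move=> sigl0 sigb0 _ _ rtil0 _ _ _ rbar0 _ fbar0 hbar0 _ Rr _ _ hB SpB _ _.
move=> [U1 [U2 [Ud [_ [_ [_ [_ [_ [_ [_ SyB]]]]]]]]]] _.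
have [Mx xM] : exists Mx, forall k t, `|x k t| <= Mx.
  case: Xc => -[Mx XM] _; exists Mx => k t.
  exact: le_trans (mx_norm_le_vnorm _ _) (XM _ (xX k t)).
have bbar0 : 0 <= bbar by apply: le_trans B0b; apply: le_trans (mx_norm_le_opnorm _ _ _).
(* Total mass 1 yields an outcome, and thereby a state whose norm shows [0 <= Mx]. *)
have [t0 _] : exists t, (setT : set T) t.
  apply/set0P/eqP => T0; have := @probability_setT _ _ _ P.
  by rewrite T0 measure0 => /esym/eqP; rewrite onee_eq0.
have Mx0 : 0 <= Mx by apply: le_trans (xM 0%N t0).
have abar0 : 0 <= abar by apply: le_trans Aa; apply: le_trans (mx_norm_le_opnorm _ _ _).
set W := @weight_mass R nx kappa; have W0 : 0 <= W := weight_mass_ge0 _.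
(* [cS] bounds the cross-covariance, [ce] the noise-free part of the innovation and [b] the gain;
   [a] adds the state, its prediction and the gain applied to [ce]. *)
pose cS := W * (Num.sqrt (`|(nx + nx)%:R + kappa| * sigb)
                * (L%:R * bbar + W * (L%:R * bbar))).
have cS0 : 0 <= cS by rewrite !(mulr_ge0, addr_ge0, sqrtr_ge0).
pose ce := L%:R * bbar + hbar + W * (L%:R * bbar).
have ce0 : 0 <= ce by rewrite !(mulr_ge0, addr_ge0)// ltW.
pose b := ny%:R * (cS * (ny%:R / rtil)).
have b0 : 0 <= b.
  by do 2 apply: mulr_ge0 => //; apply: divr_ge0 => //; exact: ltW.
pose a := Mx + W * (L%:R * abar) + b * ce.
have a0 : 0 <= a.
  by apply: addr_ge0; [apply: addr_ge0; rewrite ?mulr_ge0|exact: mulr_ge0].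
(* The index starts at 1: from then on the prior mean is a genuine prediction, and the measurement
   parameters are [Bh k] and [Rh k]. *)
have bound k t : `|x k.+1 t - xpo k.+1 t| <= a + b * `|v k.+1 t|.
  have Bk : `|Bh k t| <= bbar by apply: le_trans (Bhb k t); exact: mx_norm_le_opnorm.
  have Ak : `|Ah k t| <= abar by apply: le_trans (Ahb k t); exact: mx_norm_le_opnorm.
  have SpD j : `|Sp k.+1 t j j| <= sigb.
    have [Sl Su] := SpB k.+1 t; have /andP[lj uj] := diag_loewner _ _ _ _ Sl Su j.
    by rewrite ger0_norm// (le_trans (ltW sigl0)).
  have Syc : forall u, rtil * sqnorm u <= qform (Syy k.+1 t) u.
    exact: coercive_innovation (Ud k.+1 t).2 (ltW sigl0) (SpB k.+1 t).1 (SyB k.+1 t).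
  set e := y k.+1 t - yh k.+1 t.
  have eb : `|e| <= ce + `|v k.+1 t|.
    rewrite /e yS addrAC (le_trans (ler_normD _ _))// lerD2r.
    rewrite (le_trans (ler_normB _ _))// lerD//; last exact: mx_norm_yhat.
    (* Split [h] into its kernel expansion, bounded through [bbar], and the approximation error,
       bounded by [hbar]. *)
    rewrite -[h _](subrK (B *m Ph (x k.+1 t))) addrC (le_trans (ler_normD _ _))//.
    rewrite lerD//; last exact: le_trans (mx_norm_le_vnorm _ _) (hB _).
    by apply: mx_norm_mulPhi; apply: le_trans Bb; exact: mx_norm_le_opnorm.
  have -> : xpo k.+1 t = xpr k.+1 t + usubmx (ukf_gain dict sig kappa (Bh k t) (Rh k t)
      (prior dict sig kappa z0 S0 B0 R0 (Ah^~ t) (Bh^~ t) (Qh^~ t) (Rh^~ t)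
        (y^~ t) k.+1) *m e).
    by rewrite -linearD.
  rewrite opprD addrA (le_trans (ler_normB _ _))//.
  have xprb : `|x k.+1 t - xpr k.+1 t| <= Mx + W * (L%:R * abar).
    by rewrite (le_trans (ler_normB _ _))// lerD//; exact: mx_norm_pred_mean.
  have gainb := mx_norm_gain_mul dict sig kappa _ _ _ _ _ e rtil0 Syc
               (mx_norm_Sxy dict sig kappa _ _ _ _ Bk SpD).
  rewrite /a -addrA lerD//; apply: le_trans gainb _.
  rewrite -/W -/cS -mulrDr [leLHS](_ : _ = b * `|e|); last by rewrite /b !mulrA.
  by apply: ler_wpM2l.
have Ev k : measurable_fun setT (fun t => sqnorm (v k t)) /\
    (Esq P (v k) <= (ny%:R * (8 * rbar + 1))%:E)%E.
  exact: gaussian_vec_Esq (vg k) (ltW rbar0) (Rr k).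
pose c1 := nx%:R * (2 * a ^+ 2); pose c2 := nx%:R * (2 * b ^+ 2).
have c10 : 0 <= c1 by do 2 apply: mulr_ge0 => //; exact: sqr_ge0.
have c20 : 0 <= c2 by do 2 apply: mulr_ge0 => //; exact: sqr_ge0.
pose r := ny%:R * (8 * rbar + 1).
have r0 : 0 <= r by rewrite mulr_ge0// addr_ge0// mulr_ge0// ltW.
have Esq_ge0 k : (0 <= Esq P (fun t => (x k t - xpo k t)%R))%E.
  by apply: integral_ge0 => t _; rewrite lee_fin sqnorm_ge0.
have nu0 : 0 < c1 + c2 * r + 1 by rewrite ltr_wpDl// addr_ge0// mulr_ge0.
(* The rate 1/2 is an arbitrary choice: after time 0 the decaying term is just a nonnegative
   summand. The added 1 makes [nu] strictly positive. *)
exists 1, (c1 + c2 * r + 1), 2^-1; split=> //; first by rewrite invf_lt1// ltr1n.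
case=> [|k].
  by rewrite expr0 mul1e mule1 leeDl// lee_fin ltW.
have [mv vr] := Ev k.+1.
apply: (@le_trans _ _ (c1 + c2 * r)%:E).
  apply: Esq_affine_bound mv c10 c20 _ vr => t.
  exact: sqnorm_affine_bound a0 b0 (bound k t).
apply: (@le_trans _ _ (c1 + c2 * r + 1)%:E); first by rewrite lee_fin lerDl.
by rewrite leeDr// mul1e mule_ge0// lee_fin exprn_ge0// invr_ge0.
Qed.
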